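(* Let $G$ be a graph with minimum degree $\delta > 0$ and maximum degree $\Delta \geq 2$. If $$\frac{2\sqrt{\delta\Delta}}{\delta+\Delta} \geq \frac{\Delta(\delta-1)}{\Delta(\delta-1)+2}, \qquad (\ast)$$ then $$GA_1(G) \geq \frac{2\Delta\sqrt{\delta\Delta}}{\delta+\Delta} + \frac{\Delta(\delta-1)}{2}. \qquad (\ast\ast)$$ Furthermore, if $\Delta(\delta+1)$ is odd and both $$\frac{2\sqrt{\delta\Delta}}{\delta+\Delta} \geq \frac{\Delta(\delta-1)}{\Delta(\delta-1)+2} \quad\text{and}\quad \frac{3\sqrt{\delta\Delta}}{\delta+\Delta} + \delta - \frac{1}{2} \geq \frac{2\sqrt{(\delta+1)\Delta}}{\delta+1+\Delta} + \frac{2\delta\sqrt{\delta(\delta+1)}}{2\delta+1} \qquad (\dagger)$$ hold, then $$GA_1(G) \geq \frac{2(\Delta-1)\sqrt{\delta\Delta}}{\delta+\Delta} + \frac{2\sqrt{(\delta+1)\Delta}}{\delta+1+\Delta} + \frac{2\delta\sqrt{\delta(\delta+1)}}{2\delta+1} + \frac{(\Delta-2)(\delta-1)-1}{2}. \qquad (\dagger\dagger)$$ If $\Delta$ and $\delta$ satisfy $(\ast)$, then equality holds in $(\ast\ast)$ if and only if $\Delta(\delta+1)$ is even and $G \in \mathcal{G}_{\delta,\Delta}$. If $\Delta$ and $\delta$ satisfy $(\dagger)$ and $\Delta(\delta+1)$ is odd, then equality holds in $(\dagger\dagger)$ if and only if $G \in \mathcal{G}_{\delta,\Delta}$.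
   Context: All graphs are finite, simple (no loops or multiple edges) and have at least one edge. For a vertex $u$, $d_u$ denotes its degree. The geometric-arithmetic index of $G$ is $GA_1(G) = \sum_{uv \in E(G)} \frac{2\sqrt{d_u d_v}}{d_u + d_v}$. For integers $0 < \delta \leq \Delta$, $\mathcal{G}_{\delta,\Delta}$ denotes the set of graphs $G$ with minimum degree $\delta$ and maximum degree $\Delta$ such that: (1) if $\delta = \Delta$, $G$ is isomorphic to the complete graph $K_{\Delta+1}$; (2) if $\delta < \Delta$ and $\Delta(\delta+1)$ is even, $|V(G)| = \Delta + 1$ and there are $\Delta$ vertices of degree $\delta$; (3) if $\delta < \Delta - 1$ and $\Delta(\delta+1)$ is odd, $|V(G)| = \Delta+1$, there are $\Delta - 1$ vertices of degree $\delta$ and one vertex of degree $\delta+1$; (4) if $\delta = \Delta - 1$ and $\Delta$ is odd, $|V(G)| = \Delta + 1$, there are $\Delta - 1$ vertices of degree $\delta$ and two vertices of degree $\Delta$. *)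

(* Defs.v *)
From HB Require Import structures.
From mathcomp Require Import all_boot all_order all_algebra.
From mathcomp Require Import reals.

Set Implicit Arguments.
Unset Strict Implicit.
Unset Printing Implicit Defensive.

Import Order.TTheory GRing.Theory Num.Theory.
Local Open Scope ring_scope.

Record sgraph := SGraph {
  svertex :> finType;
  sedge : rel svertex;
  sedge_sym : symmetric sedge;
  sedge_irrefl : irreflexive sedge
}.

Definition edges (G : sgraph) : {set {set G}} :=
  [set A : {set G} | [exists u : G, exists v : G,
                        sedge u v && (A == [set u; v])]].

Definition degree (G : sgraph) (u : G) : nat := #|[set v : G | sedge u v]|.

(* The default value #|G| exceeds every degree, so on a graph with at least
   one vertex this is the genuine minimum. *)
Definition min_degree (G : sgraph) : nat :=
  \big[minn/#|G|]_(u : G) degree u.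

Definition max_degree (G : sgraph) : nat := (\max_(u : G) degree u)%N.

Definition sgraph_iso (G H : sgraph) : Prop :=
  exists2 f : G -> H, bijective f & forall u v, sedge (f u) (f v) = sedge u v.

Definition complete_rel (n : nat) : rel 'I_n := [rel i j | i != j].

Lemma complete_sym n : symmetric (@complete_rel n).
Proof. by move=> i j; rewrite /complete_rel /= eq_sym. Qed.

Lemma complete_irrefl n : irreflexive (@complete_rel n).
Proof. by move=> i; rewrite /complete_rel /= eqxx. Qed.

Definition complete (n : nat) : sgraph :=
  SGraph (@complete_sym n) (@complete_irrefl n).

(* An edge A = {u, v} has exactly two elements, so the product and the sum
   over A are d_u * d_v and d_u + d_v. *)
Definition GA1 (R : realType) (G : sgraph) : R :=
  \sum_(A in edges G)
    2 * Num.sqrt (\prod_(u in A) (degree u)%:R)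
      / (\sum_(u in A) (degree u)%:R).

Definition num_deg (G : sgraph) (k : nat) : nat :=
  #|[set u : G | degree u == k]|.

Definition extremal (delta Delta : nat) (G : sgraph) : Prop :=
  min_degree G = delta /\ max_degree G = Delta /\
  [/\ delta = Delta -> sgraph_iso G (complete Delta.+1),
      (delta < Delta)%N -> ~~ odd (Delta * (delta + 1)) ->
        #|G| = (Delta + 1)%N /\ num_deg G delta = Delta,
      (delta < Delta - 1)%N -> odd (Delta * (delta + 1)) ->
        [/\ #|G| = (Delta + 1)%N, num_deg G delta = (Delta - 1)%N
          & num_deg G (delta + 1) = 1%N]
    & delta = (Delta - 1)%N -> odd Delta ->
        [/\ #|G| = (Delta + 1)%N, num_deg G delta = (Delta - 1)%N
          & num_deg G Delta = 2%N]].

Section Bounds.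
Variables (R : realType) (delta Delta : nat).
Let d : R := delta%:R.
Let D : R := Delta%:R.

Definition star_cond : Prop :=
  2 * Num.sqrt (d * D) / (d + D) >= D * (d - 1) / (D * (d - 1) + 2).

Definition star_bound : R :=
  2 * D * Num.sqrt (d * D) / (d + D) + D * (d - 1) / 2.

Definition dagger_cond : Prop :=
  star_cond /\
  3 * Num.sqrt (d * D) / (d + D) + d - 1 / 2 >=
    2 * Num.sqrt ((d + 1) * D) / (d + 1 + D)
    + 2 * d * Num.sqrt (d * (d + 1)) / (2 * d + 1).

Definition dagger_bound : R :=
  2 * (D - 1) * Num.sqrt (d * D) / (d + D)
  + 2 * Num.sqrt ((d + 1) * D) / (d + 1 + D)
  + 2 * d * Num.sqrt (d * (d + 1)) / (2 * d + 1)
  + ((D - 2) * (d - 1) - 1) / 2.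

End Bounds.

(* Main.v *)
(* Each edge weight is at least W, the weight of a (delta, Delta) edge, with
   equality only for such edges.  Looking at a vertex of maximum degree, the
   degree sum is at least K = Delta (delta + 1).  If it is K or K + 1, the degree
   sequence is forced, and so is the multiset of edge weights: GA1 equals the
   corresponding bound.  Otherwise GA1 is bounded below by W times the number of
   edges, and (star) says that one more edge of weight W compensates for giving
   Delta (delta - 1) / 2 edges of weight 1 the weight W; (dagger) plays the same
   role for degree sums at least K + 3.  Equality would then force every edge to
   join degrees delta and Delta; if delta < Delta this gives a degree sum of at
   least 2 delta Delta, which leaves only degenerate parameters. *)
Require Import Defs.
From HB Require Import structures.
From mathcomp Require Import all_boot all_order all_algebra.
From mathcomp Require Import reals.
From mathcomp Require Import zify ring lra.

Set Implicit Arguments.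
Unset Strict Implicit.
Unset Printing Implicit Defensive.

Import Order.TTheory GRing.Theory Num.Theory.
Local Open Scope ring_scope.

(** Both factors are odd, so [delta] is even and positive, and its parity differs from that of
    [Delta]. *)
Lemma odd_mul_succ delta Delta :
    (0 < delta)%N -> (delta <= Delta)%N -> odd (Delta * (delta + 1)) ->
  [/\ odd Delta, (1 < delta)%N & (delta < Delta)%N].
Proof.
move=> d0 dD; rewrite oddM addn1 /= => /andP[oD od]; split=> //.
  by case: delta d0 od {dD} => [|[|]].
by rewrite ltn_neqAle dD andbT; apply: contraNneq od => ->.
Qed.

(** * Edge weights as a function of the two end degrees *)

Definition ga (R : realType) (a b : nat) : R :=
  2 * Num.sqrt (a%:R * b%:R) / (a%:R + b%:R).

Section Weight.
Variable R : realType.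
Implicit Types a b delta Delta : nat.

Lemma gaC a b : ga R a b = ga R b a.
Proof. by rewrite /ga mulrC [a%:R * _]mulrC [a%:R + _]addrC mulrC. Qed.

Lemma gaxx a : (0 < a)%N -> ga R a a = 1.
Proof.
move=> a0; have a0R : (0 : R) < a%:R by rewrite ltr0n.
rewrite /ga -expr2 sqrtr_sqr gtr0_norm // mulr_natl mulr2n divff //.
by rewrite gt_eqF ?addr_gt0.
Qed.

Lemma ga_gt0 a b : (0 < a)%N -> (0 < b)%N -> 0 < ga R a b.
Proof.
move=> a0 b0; rewrite /ga divr_gt0 ?mulr_gt0 ?sqrtr_gt0 ?mulr_gt0 ?ltr0n //.
by rewrite -natrD ltr0n; lia.
Qed.

Lemma ga_sqr a b : ga R a b ^+ 2 = 4 * (a%:R * b%:R) / (a%:R + b%:R) ^+ 2.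
Proof.
by rewrite /ga expr_div_n exprMn sqr_sqrtr ?mulr_ge0 // -natrX.
Qed.

Lemma ga_lt_cross a b c e : (0 < a)%N -> (0 < b)%N -> (0 < c)%N -> (0 < e)%N ->
  ((0 : R) < (a%:R * e%:R - b%:R * c%:R) * (b%:R * e%:R - a%:R * c%:R)) ->
  ga R c e < ga R a b.
Proof.
move=> a0 b0 c0 e0 H; rewrite -(@ltr_pXn2r _ 2) ?nnegrE ?ltW ?ga_gt0 //.
have ? : (0 : R) < a%:R by rewrite ltr0n.
have ? : (0 : R) < b%:R by rewrite ltr0n.
have ? : (0 : R) < c%:R by rewrite ltr0n.
have ? : (0 : R) < e%:R by rewrite ltr0n.
rewrite !ga_sqr ltr_pdivrMr ?exprn_gt0 ?addr_gt0 // mulrAC.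
rewrite ltr_pdivlMr ?exprn_gt0 ?addr_gt0 //; nra.
Qed.

(* The product in [ga_lt_cross] is the difference of the cross-multiplied
   squares; it vanishes exactly at [a / b = delta / Delta] and at its inverse. *)
Lemma ga_lt delta Delta a b : (0 < delta)%N ->
    (delta <= a <= Delta)%N -> (delta <= b <= Delta)%N ->
    ~~ [|| (a == delta) && (b == Delta) | (a == Delta) && (b == delta)] ->
  ga R delta Delta < ga R a b.
Proof.
move=> d0 aI bI nab; apply: ga_lt_cross; [lia..|].
rewrite -!natrM mulr_gt0 // subr_gt0 ltr_nat; nia.
Qed.

Lemma ga_le delta Delta a b : (0 < delta)%N ->
    (delta <= a <= Delta)%N -> (delta <= b <= Delta)%N ->
  ga R delta Delta <= ga R a b.
Proof.
move=> d0 aI bI.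
have [/orP[]/andP[/eqP-> /eqP->]|/(ga_lt d0 aI bI)/ltW //] :=
  boolP [|| (a == delta) && (b == Delta) | (a == Delta) && (b == delta)].
  by [].
by rewrite gaC.
Qed.

(** A rational lower bound for the root, sharp enough for both numerical estimates of weights made
    below. *)
Lemma sqrtr_ge_left a b : (a <= b)%N -> a%:R <= Num.sqrt (a%:R * b%:R) :> R.
Proof.
move=> ab; rewrite -{1}[a%:R]ger0_norm // -sqrtr_sqr ler_sqrt ?mulr_ge0 //.
by rewrite expr2 ler_wpM2l // ler_nat.
Qed.

End Weight.

(** * The bounds and conditions in terms of edge weights *)

Section Bound.
Variables (R : realType) (delta Delta : nat).
Hypotheses (d0 : (0 < delta)%N) (dD : (delta <= Delta)%N).
Local Notation W := (ga R delta Delta).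
Local Notation X := ((Delta * (delta - 1))%:R : R).

Let XE : X = Delta%:R * (delta%:R - 1).
Proof. by rewrite natrM natrB. Qed.

(** [X] is twice the number of edges of weight 1 in the first extremal configuration, and [X + 2]
    counts one more edge, again twice. *)
Lemma star_condE : star_cond R delta Delta <-> X <= (X + 2) * W.
Proof.
rewrite /star_cond -XE -/(ga R delta Delta) ler_pdivrMr; last first.
  by have : 0 <= X by []; lra.
by rewrite mulrC.
Qed.

(** Bounds are doubled because weights will be summed over ordered pairs of adjacent vertices: here
    [Delta] edges of weight [W] and [X] ordered pairs of weight 1. *)
Lemma star_boundE : star_bound R delta Delta *+ 2 = Delta%:R * W *+ 2 + X.
Proof. by rewrite /star_bound -XE /ga; field; rewrite -natrD pnatr_eq0; lia. Qed.

(** The terms count the edges around a hub of degree [Delta] and one vertex of degree [delta.+1].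
    The last term is the number of ordered pairs of weight 1: each of the [Delta - 1] vertices of
    degree [delta] has [delta - 1] neighbours besides the hub, and [delta] of these pairs lead to
    the exceptional vertex. *)
Lemma dagger_boundE : (0 < Delta)%N ->
  dagger_bound R delta Delta *+ 2 =
  ga R delta.+1 Delta *+ 2 + (Delta%:R - 1) * W *+ 2 +
  (delta%:R * ga R delta delta.+1) *+ 2 +
  ((Delta%:R - 1) * (delta%:R - 1) - delta%:R).
Proof.
move=> D0; rewrite /dagger_bound /ga -!(natr1 delta).
have -> : delta%:R + (delta%:R + 1) = 2 * delta%:R + 1 :> R by ring.
have : 0 <= delta%:R :> R by [].
have : 0 < Delta%:R :> R by rewrite ltr0n.
by move=> ? ?; field; apply/and3P; split; lra.
Qed.

Lemma dagger_condE : dagger_cond R delta Delta <->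
  star_cond R delta Delta /\
  ga R delta.+1 Delta + delta%:R * ga R delta delta.+1 <=
    3 / 2 * W + delta%:R - 1 / 2.
Proof.
rewrite /dagger_cond /ga -!(natr1 delta).
have -> : delta%:R + (delta%:R + 1) = 2 * delta%:R + 1 :> R by ring.
have -> : 3 / 2 * (2 * Num.sqrt (delta%:R * Delta%:R) / (delta%:R + Delta%:R)) =
    3 * Num.sqrt (delta%:R * Delta%:R) / (delta%:R + Delta%:R) :> R.
  by field; rewrite -natrD pnatr_eq0; lia.
set t := Num.sqrt (delta%:R * (delta%:R + 1)).
have -> : delta%:R * (2 * t / (2 * delta%:R + 1)) =
    2 * delta%:R * t / (2 * delta%:R + 1) by ring.
by [].
Qed.

(** When [Delta * (delta + 1)] is odd, the least possible degree sum gives [GA1] the value of the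
    second bound; this comparison keeps the first inequality strict there. *)
Lemma star_lt_dagger : (delta < Delta)%N ->
  star_bound R delta Delta < dagger_bound R delta Delta.
Proof.
move=> dltD; rewrite -(ltr_pMn2r (n := 2)) // star_boundE dagger_boundE ?XE; last by lia.
have h1 : W < ga R delta.+1 Delta by apply: ga_lt; lia.
(* The doubled bounds differ by [2 * delta - 1] ordered pairs of weight 1, which twice this estimate
   makes up for. With the root replaced by [delta] it reduces to (2 delta - 1)(2 delta + 1) <= 4
   delta^2. *)
have h2 : delta%:R - 1 / 2 <= delta%:R * ga R delta delta.+1.
  rewrite /ga -!(natr1 delta).
  have h := sqrtr_ge_left R (leqnSn delta).
  have p : 0 < delta%:R :> R by rewrite ltr0n.
  rewrite mulrA ler_pdivlMr; last by lra.
  rewrite -(natr1 delta) in h; have := ler_wpM2l (ltW p) h; lra.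
lra.
Qed.

End Bound.

(** * Double counting and degrees in a graph *)

Section Graph.
Variable G : sgraph.
Implicit Types u v x y : G.

Lemma sedge_neq u v : sedge u v -> u != v.
Proof. by apply: contraTneq => ->; rewrite sedge_irrefl. Qed.

(** The map from ordered adjacent pairs to edges has fibres {(x, y), (y, x)}, of size two because
    there are no loops. *)
Lemma sum_edges (V : nmodType) (F : {set G} -> V) :
  (\sum_(A in edges G) F A) *+ 2 = \sum_u \sum_(v | sedge u v) F [set u; v].
Proof.
rewrite pair_big_dep /=.
rewrite (partition_big (fun p : G * G => [set p.1; p.2]) (mem (edges G))) /=; last first.
  move=> [u v] /= uv; rewrite inE; apply/existsP; exists u.
  by apply/existsP; exists v; rewrite uv /=.
rewrite -sumrMnl; apply: eq_bigr => A.
rewrite inE => /existsP[x /existsP[y /andP[xy /eqP->]]].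
have nxy := sedge_neq xy.
rewrite (eq_bigr (fun=> F [set x; y])); last by move=> p /andP[_ /eqP->].
rewrite (eq_bigl (mem [set (x, y); (y, x)])); last first.
  move=> [u v]; rewrite /= !inE !xpair_eqE; apply/idP/idP.
    move=> /andP[/sedge_neq nuv /eqP E].
    have : u \in [set x; y] by rewrite -E set21.
    have : v \in [set x; y] by rewrite -E set22.
    rewrite !inE => /orP[]/eqP Ev /orP[]/eqP Eu;
      by move: nuv; rewrite Eu Ev !eqxx ?orbT.
  case/orP => /andP[/eqP-> /eqP->]; first by rewrite xy /=.
  by rewrite sedge_sym xy setUC /=.
by rewrite sumr_const cards2 xpair_eqE negb_and nxy.
Qed.

Lemma sum_degree : (\sum_(u : G) degree u = #|edges G| * 2)%N.
Proof.
have := sum_edges (fun=> 1%N); rewrite sum1_card mulr2n => E.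
rewrite muln2 -addnn; apply: etrans (esym E); apply: eq_bigr => u _.
by rewrite /degree -sum1_card; apply: eq_bigl => v; rewrite inE.
Qed.

Lemma sum_nbr_const (R : pzSemiRingType) u (c : R) :
  \sum_(v | sedge u v) c = (degree u)%:R * c.
Proof.
rewrite /degree mulr_natl -sumr_const.
by apply: eq_bigl => v; rewrite inE.
Qed.

Lemma degree_le_max u : (degree u <= max_degree G)%N.
Proof. exact: leq_bigmax. Qed.

Lemma min_degree_le u : (min_degree G <= degree u)%N.
Proof.
rewrite /min_degree; elim: (index_enum G) (mem_index_enum u) => //= v s IHs.
rewrite inE big_cons geq_min => /predU1P[->|/IHs->]; first by rewrite leqnn.
by rewrite orbT.
Qed.

Lemma max_degree_attained :
  (0 < max_degree G)%N -> exists u, degree u = max_degree G.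
Proof.
move=> D0; have [|u Eu] := bigop.eq_bigmax (@degree G).
  rewrite lt0n; apply: contraTneq D0 => /card0_eq G0.
  by rewrite /max_degree big_pred0.
by exists u; rewrite /max_degree Eu.
Qed.

Lemma min_degree_le_max : (0 < max_degree G)%N -> (min_degree G <= max_degree G)%N.
Proof. by case/max_degree_attained=> v <-; apply: min_degree_le. Qed.

Lemma degree_lt_card u : (degree u < #|G|)%N.
Proof.
rewrite /degree -cardsT; apply: proper_card; rewrite properT.
by apply/negP => /eqP/setP/(_ u); rewrite !inE sedge_irrefl.
Qed.

(** The neighbourhood of [u] lies in the complement of [u], and here the two have the same size. *)
Lemma degree_full u : #|G| = (degree u).+1 -> forall v, sedge u v = (u != v).
Proof.
move=> E v.
have /eqP/setP/(_ v) : [set v | sedge u v] == [set~ u].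
  rewrite eqEcard; apply/andP; split.
    by apply/subsetP => w; rewrite !inE eq_sym; apply: sedge_neq.
  by rewrite cardsC1 E leqnn.
by rewrite !inE eq_sym.
Qed.

(** Isolates the total excess over the minimum degree. For [v0] of maximum degree, [#|G|.-1] is at
    least that degree, so a small degree sum forces both the order of the graph and this excess. *)
Lemma sum_degree_min v0 :
  (\sum_(u : G) degree u =
   degree v0 + #|G|.-1 * min_degree G + \sum_(u | u != v0) (degree u - min_degree G))%N.
Proof.
rewrite (bigD1 v0) //= -addnA; congr addn.
have -> : (#|G|.-1 * min_degree G = \sum_(u | u != v0) min_degree G)%N.
  rewrite -(cardsC1 v0) -sum_nat_const.
  by apply: eq_bigl => u; rewrite !inE.
by rewrite -big_split /=; apply: eq_bigr => u _; rewrite subnKC // min_degree_le.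
Qed.

(** Any bijection works, since adjacency is inequality on both sides; the one used is the
    enumeration of the vertices. *)
Lemma iso_complete n :
  #|G| = n.+1 -> (forall u, degree u = n) -> sgraph_iso G (complete n.+1).
Proof.
move=> cG dG; exists (fun u => cast_ord cG (enum_rank u)).
  exists (fun i => enum_val (cast_ord (esym cG) i)) => [u|i].
    by rewrite cast_ordK enum_rankK.
  by rewrite enum_valK cast_ordKV.
move=> u v; rewrite degree_full ?dG //.
congr (~~ _); apply: (inj_eq (f := fun w => cast_ord cG (enum_rank w))).
exact: inj_comp (@cast_ord_inj _ _ _) enum_rank_inj.
Qed.

Lemma num_deg_compl k (A : {set G}) :
  [set u | degree u == k] = ~: A -> (num_deg G k + #|A| = #|G|)%N.
Proof. by rewrite /num_deg => ->; rewrite addnC cardsC. Qed.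

Lemma card_deg_neq k :
  #|[set u : G | degree u != k]| = (#|G| - num_deg G k)%N.
Proof.
rewrite /num_deg -(cardsC [set u : G | degree u == k]) addKn.
by apply: eq_card => u; rewrite !inE.
Qed.

End Graph.

(** * The index as a sum over ordered adjacent pairs *)

Section Double.
Variables (R : realType) (G : sgraph).
Implicit Types u v : G.

Lemma GA1_double :
  GA1 R G *+ 2 = \sum_(u : G) \sum_(v | sedge u v) ga R (degree u) (degree v).
Proof.
rewrite /GA1 sum_edges; apply: eq_bigr => u _; apply: eq_bigr => v uv.
by rewrite !big_setU1 ?big_set1 // inE (sedge_neq uv).
Qed.

Lemma sum_nbr_neq_const u v (c : R) : sedge u v ->
  \sum_(x | sedge u x && (x != v)) c = ((degree u)%:R - 1) * c.
Proof.
move=> uv; have := sum_nbr_const u c; rewrite (bigD1 v) //=.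
by move=> E; rewrite mulrBl -E; ring.
Qed.

Lemma sum_nbr_const_nat u c : (\sum_(v | sedge u v) c = degree u * c)%N.
Proof. by rewrite -sum_nat_const; apply: eq_bigl => v; rewrite inE. Qed.

End Double.

(** The order makes [v0] adjacent to every other vertex. This single form covers both the complete
    graph and the case [delta < Delta]. *)
Definition star_degrees (delta Delta : nat) (G : sgraph) : Prop :=
  #|G| = Delta.+1 /\
  exists2 v0 : G, degree v0 = Delta & forall u, u != v0 -> degree u = delta.

(** Here [u1] carries one unit of excess over the minimum degree. Allowing [delta.+1 = Delta] merges
    the two odd clauses of [extremal]. *)
Definition dagger_degrees (delta Delta : nat) (G : sgraph) : Prop :=
  #|G| = Delta.+1 /\
  exists v0 u1 : G, [/\ u1 != v0, degree v0 = Delta, degree u1 = delta.+1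
    & forall u, u != v0 -> u != u1 -> degree u = delta].

(** * Degree sequences forced by a small degree sum *)

Section DegreeSum.
Variables (G : sgraph) (delta Delta : nat).
Hypotheses (hmin : min_degree G = delta) (hmax : max_degree G = Delta).

Let dI u : (delta <= degree (u : G) <= Delta)%N.
Proof. by rewrite -hmin -hmax min_degree_le degree_le_max. Qed.

Lemma sum_degree_ge : (0 < Delta)%N ->
  (Delta * (delta + 1) <= \sum_(u : G) degree u)%N.
Proof.
move=> D0; have [|v0 dv0] := @max_degree_attained G; first by lia.
rewrite (sum_degree_min v0) dv0 hmin hmax.
have := degree_lt_card v0; rewrite dv0 hmax; nia.
Qed.

Lemma sum_degree_star : (0 < delta)%N -> (0 < Delta)%N ->
  (\sum_(u : G) degree u = Delta * (delta + 1))%N -> star_degrees delta Delta G.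
Proof.
move=> d0 D0; have [|v0 dv0] := @max_degree_attained G; first by lia.
have := degree_lt_card v0.
rewrite (sum_degree_min v0) dv0 hmin hmax; set T := (\sum_(u | _) _)%N => cG E.
have cGE : #|G| = Delta.+1 by nia.
have /eqP : T = 0%N by nia.
rewrite sum_nat_eq0 => /forall_inP H; split=> //; exists v0; first by rewrite dv0.
by move=> u /H; move: (dI u); lia.
Qed.

Lemma sum_degree_dagger : (0 < Delta)%N -> (1 < delta)%N ->
  (\sum_(u : G) degree u = Delta * (delta + 1) + 1)%N ->
  dagger_degrees delta Delta G.
Proof.
move=> D0 d1; have [|v0 dv0] := @max_degree_attained G; first by lia.
have := degree_lt_card v0.
rewrite (sum_degree_min v0) dv0 hmin hmax; set T := (\sum_(u | _) _)%N => cG E.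
(* A further vertex would add [delta >= 2] to the sum, which exceeds its minimum by only 1. *)
have cGE : #|G| = Delta.+1 by nia.
have /eqP/sum_nat_eq1[u1 [nu1 du1 H]] : T = 1%N by nia.
split=> //; exists v0, u1; split=> //; first by rewrite dv0.
  by move: (dI u1); lia.
by move=> u nu nuu; have := H u nuu nu; move: (dI u); lia.
Qed.

End DegreeSum.

(** * Values of the index on the forced sequences, and estimates by size *)

Section Evaluation.
Variables (R : realType) (G : sgraph) (delta Delta : nat).
Hypotheses (d0 : (0 < delta)%N) (dD : (delta <= Delta)%N).
Local Notation W := (ga R delta Delta).

(** The row of the hub [v0] contributes [Delta] times [W]; every other row meets the hub once and
    otherwise only vertices of degree [delta], so it is [W + (delta - 1)]. *)
Lemma GA1_star_degrees :
  star_degrees delta Delta G -> GA1 R G = star_bound R delta Delta.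
Proof.
case=> cG [v0 dv0 du].
apply: (mulIf (x := 2%:R)); first by rewrite pnatr_eq0.
rewrite !mulr_natr star_boundE // GA1_double (bigD1 v0) //=.
have adj0 : forall u, sedge v0 u = (v0 != u) by apply: degree_full; rewrite dv0.
rewrite (eq_bigr (fun=> W)); last first.
  by move=> v; rewrite adj0 => nv; rewrite dv0 du 1?eq_sym // gaC.
rewrite sum_nbr_const dv0.
rewrite (eq_bigr (fun=> W + (delta%:R - 1))); last first.
  move=> u nu; have uv0 : sedge u v0 by rewrite sedge_sym adj0 eq_sym.
  rewrite (bigD1 v0) //= dv0 du //; congr (_ + _).
  rewrite (eq_bigr (fun=> 1)); last by move=> v /andP[_ nv]; rewrite du // gaxx.
  by rewrite sum_nbr_neq_const // mulr1 du.
rewrite (eq_bigl (mem [set~ v0])); last by move=> u; rewrite !inE.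
rewrite sumr_const cardsC1 cG /= -mulr_natl natrM natrB //; ring.
Qed.

Lemma GA1_dagger_degrees : (0 < Delta)%N ->
  dagger_degrees delta Delta G -> GA1 R G = dagger_bound R delta Delta.
Proof.
move=> D0 [cG [v0 [u1 [nu1 dv0 du1 du]]]].
apply: (mulIf (x := 2%:R)); first by rewrite pnatr_eq0.
rewrite !mulr_natr dagger_boundE // GA1_double (bigD1 v0) //= [X in _ + X](bigD1 u1) //=.
have adj0 : forall u, sedge v0 u = (v0 != u) by apply: degree_full; rewrite dv0.
have v0u1 : sedge v0 u1 by rewrite adj0 eq_sym.
have u1v0 : sedge u1 v0 by rewrite sedge_sym.
rewrite (bigD1 u1) //= dv0 du1 (eq_bigr (fun=> W)); last first.
  by move=> v /andP[]; rewrite adj0 => nv nv1; rewrite du 1?eq_sym 1?gaC // eq_sym.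
rewrite sum_nbr_neq_const // dv0.
rewrite (bigD1 v0) //= dv0 (eq_bigr (fun=> ga R delta delta.+1)); last first.
  move=> v /andP[u1v nv]; rewrite gaC (du v) // eq_sym; exact: sedge_neq.
rewrite sum_nbr_neq_const // du1.
set w := ga R delta delta.+1.
(* A row of a vertex of degree [delta] is as in the first configuration, except that an edge to [u1]
   replaces a weight 1 by [w]. The correction occurs [delta] times, once for each neighbour of [u1]
   other than [v0]. *)
rewrite (eq_bigr (fun u => (W + (delta%:R - 1)) +
                           (if sedge u1 u then w - 1 else 0))); last first.
  move=> u /andP[nu nuu1].
  have uv0 : sedge u v0 by rewrite sedge_sym adj0 eq_sym.
  have row1 : \sum_(x | sedge u x && (x != v0)) 1 = delta%:R - 1 :> R.
    by rewrite sum_nbr_neq_const // mulr1 du.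
  rewrite (bigD1 v0) //= dv0 (du u) // -addrA; congr (_ + _).
  rewrite -row1 sedge_sym; have [uu1|nuu] := ifPn; last first.
    rewrite addr0; apply: eq_bigr => v /andP[uv nv].
    by rewrite (du v) ?gaxx //; apply: contraNneq nuu => <-.
  rewrite (bigD1 u1) ?uu1 //= [in RHS](bigD1 u1) ?uu1 //= du1 -/w.
  rewrite (eq_bigr (fun=> 1)); first by ring.
  by move=> v /andP[/andP[_ nv] nv1]; rewrite du ?gaxx.
rewrite big_split /= -big_mkcondr /=.
have -> : \sum_(u | (u != v0) && (u != u1)) (W + (delta%:R - 1)) =
    (Delta%:R - 1) * (W + (delta%:R - 1)).
  (* The sum over all [Delta + 1] vertices, from which the terms at [v0] and [u1] are then
     cancelled. *)
  have : \sum_(u : G) (W + (delta%:R - 1)) = #|G|%:R * (W + (delta%:R - 1)).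
    by rewrite sumr_const mulr_natl.
  rewrite (bigD1 v0) //= (bigD1 u1) //= cG -natr1 => E.
  by apply: (addrI (W + (delta%:R - 1))); apply: (addrI (W + (delta%:R - 1)));
     rewrite E; ring.
rewrite (eq_bigl (fun u => sedge u1 u && (u != v0))); last first.
  move=> u; rewrite andbC; case: (boolP (sedge u1 u)) => //= /sedge_neq.
  by rewrite eq_sym => ->; rewrite andbT.
by rewrite sum_nbr_neq_const // du1 [ga R Delta _]gaC -!(natr1 delta); ring.
Qed.

Hypotheses (hmin : min_degree G = delta) (hmax : max_degree G = Delta).

Let dI u : (delta <= degree (u : G) <= Delta)%N.
Proof. by rewrite -hmin -hmax min_degree_le degree_le_max. Qed.

Lemma GA1_ge_size : (\sum_(u : G) degree u)%:R * W <= GA1 R G *+ 2.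
Proof.
rewrite GA1_double natr_sum mulr_suml; apply: ler_sum => u _.
rewrite -sum_nbr_const; apply: ler_sum => v _; exact: ga_le.
Qed.

Lemma GA1_gt_size (u v : G) : sedge u v ->
    ~~ [|| (degree u == delta) && (degree v == Delta)
         | (degree u == Delta) && (degree v == delta)] ->
  (\sum_(u : G) degree u)%:R * W < GA1 R G *+ 2.
Proof.
move=> uv nuv; rewrite GA1_double natr_sum mulr_suml.
under eq_bigr do rewrite -sum_nbr_const.
rewrite !pair_big_dep /= (bigD1 (u, v)) //= [ltRHS](bigD1 (u, v)) //=.
apply: ltr_leD; first exact: ga_lt.
by apply: ler_sum => p _; apply: ga_le.
Qed.

(** Take an edge from [v0] of degree [Delta] to [u1] of degree [delta]. The [Delta] neighbours of
    [v0] have degree [delta] and the [delta] neighbours of [u1] have degree [Delta]. These sets are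
    disjoint because the two degrees differ, and each contributes [delta * Delta]. *)
Lemma sum_degree_biregular : (delta < Delta)%N ->
    (forall u v : G, sedge u v ->
      [|| (degree u == delta) && (degree v == Delta)
        | (degree u == Delta) && (degree v == delta)]) ->
  (2 * delta * Delta <= \sum_(u : G) degree u)%N.
Proof.
move=> dltD H.
have [|v0 dv0] := @max_degree_attained G; first by lia.
have [u1 vu1] : exists u1, sedge v0 u1.
  have /card_gt0P[u1] : (0 < degree v0)%N by lia.
  by rewrite inE; exists u1.
have du1 : degree u1 = delta by have := H _ _ vu1; lia.
have -> : (2 * delta * Delta =
    \sum_(u : G) ((if sedge v0 u then delta else 0) +
                  (if sedge u1 u then Delta else 0)))%N.
  rewrite big_split /= -!big_mkcond /= !sum_nbr_const_nat du1 dv0 hmax; lia.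
apply: leq_sum => u _; move: (dI u).
have [/H vu|_] := boolP (sedge v0 u); have [/H uu|_] := boolP (sedge u1 u); lia.
Qed.

Lemma GA1_gt_size_small : (delta < Delta)%N ->
    (\sum_(u : G) degree u < 2 * delta * Delta)%N ->
  (\sum_(u : G) degree u)%:R * W < GA1 R G *+ 2.
Proof.
move=> dltD Nlt.
pose good (u v : G) := [|| (degree u == delta) && (degree v == Delta)
                   | (degree u == Delta) && (degree v == delta)].
have [/forallP H|] := boolP [forall u, [forall v, sedge u v ==> good u v]].
  move: Nlt; rewrite ltnNge sum_degree_biregular // => u v uv.
  by have /forallP/(_ v)/implyP/(_ uv) := H u.
rewrite negb_forall => /existsP[u]; rewrite negb_forall => /existsP[v].
by rewrite negb_imply => /andP[uv nuv]; apply: GA1_gt_size nuv.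
Qed.

End Evaluation.

(** * Strict inequality for larger degree sums *)

Section Strict.
Variables (R : realType) (G : sgraph) (delta Delta : nat).
Hypotheses (d0 : (0 < delta)%N) (D2 : (2 <= Delta)%N).
Hypotheses (hmin : min_degree G = delta) (hmax : max_degree G = Delta).
Local Notation W := (ga R delta Delta).
Local Notation N := (\sum_(u : G) degree u)%N.

Let dD : (delta <= Delta)%N.
Proof. by rewrite -hmin -hmax min_degree_le_max // hmax; lia. Qed.

Lemma star_bound_lt_GA1 : star_cond R delta Delta ->
  (Delta * (delta + 1) + 2 <= N)%N -> star_bound R delta Delta < GA1 R G.
Proof.
move=> /(star_condE R Delta d0) hs hN.
rewrite -(ltr_pMn2r (n := 2)) // star_boundE //.
have W0 : 0 < W by apply: ga_gt0; lia.
have S1 := GA1_ge_size R d0 hmin hmax.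
have KE : (Delta * (delta + 1) + 2 = Delta * (delta - 1) + 2 * Delta + 2)%N by nia.
have KR : (Delta * (delta + 1) + 2)%:R =
    (Delta * (delta - 1))%:R + 2 * Delta%:R + 2 :> R.
  by rewrite KE 2!natrD (natrM _ 2).
set X := (Delta * (delta - 1))%:R in hs KR *.
(* The threshold splits as [X + 2] plus [2 * Delta] ordered pairs, and the condition bounds
   [(X + 2) * W] below by [X]. *)
have sE : X + 2 * Delta%:R * W <= (Delta * (delta + 1) + 2)%:R * W.
  by rewrite KR; nra.
move: hN; rewrite leq_eqVlt => /orP[/eqP NE|Nlt]; last first.
  have : (Delta * (delta + 1) + 2)%:R * W < N%:R * W by rewrite ltr_pM2r // ltr_nat.
  by move: S1 sE; lra.
have [dltD|Dled] := ltnP delta Delta; last first.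
  have dE : delta = Delta by lia.
  move: S1 sE; rewrite -NE KR dE gaxx; [|lia].
  lra.
have [Nlt|Nge] := ltnP N (2 * delta * Delta).
  have := GA1_gt_size_small R d0 dD hmin hmax dltD Nlt.
  by rewrite -NE; move: sE; lra.
(* A degree sum of at least [2 * delta * Delta] means [Delta * (delta - 1) <= 2]. For [delta = 1]
   there are no pairs of weight 1 to compensate, so the two extra pairs give a strict gain. *)
have d1 : delta = 1%N by nia.
have X0 : X = 0 by rewrite /X d1 subnn muln0.
by move: S1; rewrite -NE KR X0; lra.
Qed.

Lemma dagger_bound_lt_GA1 : odd (Delta * (delta + 1)) ->
  dagger_cond R delta Delta ->
  (Delta * (delta + 1) + 3 <= N)%N -> dagger_bound R delta Delta < GA1 R G.
Proof.
move=> oD /(dagger_condE R d0 dD) [/(star_condE R Delta d0) hs hd] hN.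
rewrite -(ltr_pMn2r (n := 2)) // dagger_boundE //; [|lia..].
have [oDelta d2 dltD] := odd_mul_succ d0 dD oD.
have W0 : 0 < W by apply: ga_gt0; lia.
have S1 := GA1_ge_size R d0 hmin hmax.
have KE : (Delta * (delta + 1) + 3 = Delta * (delta - 1) + 2 * Delta + 3)%N by nia.
have KR : (Delta * (delta + 1) + 3)%:R =
    (Delta * (delta - 1))%:R + 2 * Delta%:R + 3 :> R.
  by rewrite KE 2!natrD (natrM _ 2).
have XE : (Delta * (delta - 1))%:R = Delta%:R * (delta%:R - 1) :> R.
  by rewrite natrM natrB.
set X := (Delta * (delta - 1))%:R in hs KR XE *.
set b := (X in X < _).
(* The second half of the condition trades the edges at the vertex of degree [delta.+1] for weights
   [W] and 1. The first half then gives [kE] as before, through [X <= (X + 2) * W]. *)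
have sE : b <= X + (2 * Delta%:R + 1) * W by rewrite /b XE; lra.
have kE : X + (2 * Delta%:R + 1) * W <= (Delta * (delta + 1) + 3)%:R * W.
  by rewrite KR; lra.
move: hN; rewrite leq_eqVlt => /orP[/eqP NE|Nlt]; last first.
  have : (Delta * (delta + 1) + 3)%:R * W < N%:R * W by rewrite ltr_pM2r // ltr_nat.
  by move: S1 sE kE; lra.
have [Nlt|Nge] := ltnP N (2 * delta * Delta).
  have := GA1_gt_size_small R d0 dD hmin hmax dltD Nlt.
  by rewrite -NE; move: sE kE; lra.
(* Only K_(2,3) is left: there [4 / 5 <= W], so the hypothesis is strict. *)
have [dE DE] : delta = 2%N /\ Delta = 3%N by nia.
have W45 : 4 / 5 <= W.
  have := sqrtr_ge_left R dD; rewrite /ga dE DE => h.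
  rewrite ler_pdivlMr; lra.
have X3 : X = 3 by rewrite XE dE DE; ring.
by move: S1; rewrite -NE KR X3; lra.
Qed.

End Strict.

(** * The extremal class described by degree sequences *)

Section ExtremalDegrees.
Variables (G : sgraph) (delta Delta : nat).
Hypotheses (d0 : (0 < delta)%N) (D2 : (2 <= Delta)%N).
Hypotheses (hmin : min_degree G = delta) (hmax : max_degree G = Delta).

Let dD : (delta <= Delta)%N.
Proof. by rewrite -hmin -hmax min_degree_le_max // hmax; lia. Qed.

(** When [delta < Delta], the second clause leaves one vertex of degree other than [delta], and it
    must be the one of maximum degree. The last two clauses are vacuous: for [delta = Delta - 1] and
    [Delta] odd, the product would be the odd number [Delta * Delta]. *)
Lemma star_degreesP : ~~ odd (Delta * (delta + 1)) ->
  extremal delta Delta G <-> star_degrees delta Delta G.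
Proof.
move=> eD; split=> [[_ [_ [h1 h2 _ _]]]|[cG [v0 dv0 du]]].
  have [|v0 dv0] := @max_degree_attained G; first by lia.
  rewrite hmax in dv0.
  have [dltD|Dled] := ltnP delta Delta; last first.
    have dE : delta = Delta by lia.
    have [f bf _] := h1 dE.
    split; first by rewrite (bij_eq_card bf) card_ord.
    exists v0 => // u _.
    by have := min_degree_le u; have := degree_le_max u; lia.
  have [cG nd] := h2 dltD eD; rewrite addn1 in cG.
  split=> //; exists v0 => // u nu; apply: contraNeq nu => du.
  have /cards1P[w E] : #|[set u : G | degree u != delta]| == 1%N.
    by rewrite card_deg_neq cG nd; lia.
  have : u \in [set w] by rewrite -E inE.
  have : v0 \in [set w] by rewrite -E inE dv0; lia.
  by rewrite !inE => /eqP-> /eqP->.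
do 2![split=> //]; split=> [dE|dltD _|_|dE oD].
- apply: iso_complete => // u; have [->//|/du->//] := eqVneq u v0.
- split; first by rewrite addn1.
  have -> : Delta = (#|G| - #|[set v0]|)%N by rewrite cG cards1 subn1.
  rewrite -(@num_deg_compl G delta [set v0]) ?addnK //.
  apply/setP => u; rewrite !inE; have [->|/du->] := eqVneq u v0; last by rewrite eqxx.
  by rewrite dv0; lia.
- by rewrite (negbTE eD).
- by move: eD; rewrite oddM dE subnK ?oD //; lia.
Qed.

(** Both odd clauses yield a vertex of degree [delta.+1] besides [v0]; when [delta = Delta - 1] it
    is the second vertex of degree [Delta]. *)
Lemma dagger_degreesP : odd (Delta * (delta + 1)) ->
  extremal delta Delta G <-> dagger_degrees delta Delta G.
Proof.
move=> oD.
have [oDelta _ dltD] := odd_mul_succ d0 dD oD.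
split=> [[_ [_ [_ _ h3 h4]]]|[cG [v0 [u1 [nu1 dv0 du1 du]]]]].
  have [|v0 dv0] := @max_degree_attained G; first by lia.
  rewrite hmax in dv0.
  have [cG nd [u1 nu1 du1]] : [/\ #|G| = Delta.+1, num_deg G delta = (Delta - 1)%N
      & exists2 u1 : G, u1 != v0 & degree u1 = delta.+1].
    have [lt1|ge1] := ltnP delta (Delta - 1).
      have [cG nd nd1] := h3 lt1 oD; split=> //; first by rewrite cG addn1.
      have /card_gt0P[u1] : (0 < num_deg G (delta + 1))%N by rewrite nd1.
      rewrite inE addn1 => /eqP du1; exists u1 => //.
      by apply: contra_eq_neq du1 => ->; rewrite dv0; lia.
    have dE : delta = (Delta - 1)%N by lia.
    have [cG nd nd1] := h4 dE oDelta; split=> //; first by rewrite cG addn1.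
    have : (0 < #|[set u : G | degree u == Delta] :\ v0|)%N.
      by move: nd1; rewrite /num_deg (cardsD1 v0) inE dv0 eqxx; lia.
    case/card_gt0P => u1; rewrite !inE => /andP[nu1 /eqP du1].
    by exists u1 => //; rewrite du1; lia.
  split=> //; exists v0, u1; split=> // u nu nuu.
  (* Otherwise [v0], [u1] and [u] are three vertices of degree other than [delta], whereas only
     (Delta + 1) - (Delta - 1) = 2 exist. *)
  apply: contraTeq (leqnn 2) => du; rewrite -ltnNge.
  have {2}-> : 2%N = #|[set u : G | degree u != delta]|.
    by rewrite card_deg_neq cG nd; lia.
  rewrite (cardsD1 v0) (cardsD1 u1) (cardsD1 u) !inE dv0 du1 du nu nuu nu1.
  by lia.
have ndE : num_deg G delta = (Delta - 1)%N.
  have -> : (Delta - 1 = #|G| - #|[set v0; u1]|)%N.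
    by rewrite cG cards2 eq_sym nu1; lia.
  rewrite -(@num_deg_compl G delta [set v0; u1]) ?addnK //.
  apply/setP => u; rewrite !inE; have [->|nu] := eqVneq u v0.
    by rewrite dv0; lia.
  have [->|nuu] := eqVneq u u1; first by rewrite du1; lia.
  by rewrite du // eqxx.
do 2![split=> //]; split=> [dE|_|lt1 _|dE _]; [lia|by rewrite oD| |].
  split; rewrite ?addn1 //; apply/eqP/cards1P; exists u1; apply/setP => u.
  rewrite !inE; have [->|nu] := eqVneq u v0.
    by rewrite dv0 [v0 == u1]eq_sym (negbTE nu1); lia.
  have [->|nuu] := eqVneq u u1; first by rewrite du1 eqxx.
  by rewrite du //; lia.
split; rewrite ?addn1 //; rewrite /num_deg.
have -> : [set u : G | degree u == Delta] = [set v0; u1].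
  apply/setP => u; rewrite !inE; have [->|nu] := eqVneq u v0.
    by rewrite dv0 eqxx.
  have [->|nuu] := eqVneq u u1; first by rewrite du1; lia.
  by rewrite du //; lia.
by rewrite cards2 eq_sym nu1.
Qed.

End ExtremalDegrees.

Theorem theorem2p11 (R : realType) (G : sgraph) (delta Delta : nat)
    (hE : edges G != set0)
    (hmin : min_degree G = delta) (hmax : max_degree G = Delta)
    (hdelta : (0 < delta)%N) (hDelta : (2 <= Delta)%N) :
  [/\ star_cond R delta Delta -> GA1 R G >= star_bound R delta Delta,
      odd (Delta * (delta + 1)) -> dagger_cond R delta Delta ->
        GA1 R G >= dagger_bound R delta Delta,
      star_cond R delta Delta ->
        (GA1 R G = star_bound R delta Delta <->
         ~~ odd (Delta * (delta + 1)) /\ extremal delta Delta G)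
    & dagger_cond R delta Delta -> odd (Delta * (delta + 1)) ->
        (GA1 R G = dagger_bound R delta Delta <->
         extremal delta Delta G)].
Proof.
have D0 : (0 < Delta)%N by lia.
have dD : (delta <= Delta)%N by rewrite -hmin -hmax min_degree_le_max ?hmax.
have Nge := sum_degree_ge hmin hmax D0.
(* Parity separates the cases. If [Delta * (delta + 1)] is odd, the degree sum exceeds it by exactly
   1 or by at least 3; if it is even, by 0 or by at least 2. *)
have Neven : ~~ odd (\sum_(u : G) degree u) by rewrite sum_degree oddM andbF.
have [oD|eD] := boolP (odd (Delta * (delta + 1))).
  have [_ d1 dltD] := odd_mul_succ hdelta dD oD.
  have dcases : dagger_degrees delta Delta G \/
                (Delta * (delta + 1) + 3 <= \sum_(u : G) degree u)%N.
    have [NE|NE] := eqVneq (\sum_(u : G) degree u)%N (Delta * (delta + 1) + 1)%N.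
      by left; apply: sum_degree_dagger.
    by right; lia.
  (* In the odd case the first bound is never attained, in agreement with the evenness required in
     its equality case. *)
  have star_lt : star_cond R delta Delta -> star_bound R delta Delta < GA1 R G.
    move=> hs; case: dcases => [/(GA1_dagger_degrees R hdelta D0)->|N3].
      exact: star_lt_dagger.
    by apply: star_bound_lt_GA1 => //; lia.
  split=> [/star_lt/ltW //|_ hd|/star_lt lt|hd _].
  - by case: dcases => [/(GA1_dagger_degrees R hdelta D0)->//|N3];
      apply/ltW/dagger_bound_lt_GA1.
  - by split=> [E|[]//]; rewrite E ltxx in lt.
  - rewrite (dagger_degreesP hdelta hDelta hmin hmax oD).
    split=> [E|/(GA1_dagger_degrees R hdelta D0)//].
    case: dcases => // /(dagger_bound_lt_GA1 hdelta hDelta hmin hmax oD hd).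
    by rewrite E ltxx.
have scases : star_degrees delta Delta G \/
              (Delta * (delta + 1) + 2 <= \sum_(u : G) degree u)%N.
  have [NE|NE] := eqVneq (\sum_(u : G) degree u)%N (Delta * (delta + 1))%N.
    by left; apply: sum_degree_star.
  by right; lia.
split=> // hs.
  by case: scases => [/(GA1_star_degrees R hdelta dD)->//|N2];
    apply/ltW/star_bound_lt_GA1.
rewrite (star_degreesP hdelta hDelta hmin hmax eD).
split=> [E|[_ /(GA1_star_degrees R hdelta dD)//]]; split=> //.
case: scases => // /(star_bound_lt_GA1 hdelta hDelta hmin hmax hs).
by rewrite E ltxx.
Qed.
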